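(* Let $H$ and $K$ be groups. Suppose that at least one of the following holds: (a) $H$ and $K$ are incompatible and both satisfy the minimal condition on normal subgroups; or (b) $H$ and $K$ are totally incompatible. Then $\operatorname{Aut}(H\times K)\simeq\mathcal{A}_{H,K}$.
   Context: An endomorphism $\varphi$ of $H\times K$ is identified with the matrix $\begin{pmatrix}\alpha&\beta\\ \gamma&\delta\end{pmatrix}$, where $\alpha\in\operatorname{End}H$, $\beta\in\operatorname{Hom}(K,H)$, $\gamma\in\operatorname{Hom}(H,K)$, $\delta\in\operatorname{End}K$ and $\varphi(h,k)=(\alpha(h)\beta(k),\gamma(h)\delta(k))$; composition corresponds to row-by-column multiplication, with $(f+g)(x)=f(x)g(x)$. The set $\mathcal{A}_{H,K}$ consists of all such matrices with $\alpha\in\operatorname{Aut}H$, $\delta\in\operatorname{Aut}K$, $\beta\in\operatorname{Hom}(K,Z(H))$, $\gamma\in\operatorname{Hom}(H,Z(K))$. The notation $\operatorname{Aut}(H\times K)\simeq\mathcal{A}_{H,K}$ means that under this identification the set of automorphisms of $H\times K$ is exactly $\mathcal{A}_{H,K}$. An endomorphism of a group is normal if it commutes with every inner automorphism. $H$ and $K$ are incompatible if for all $\sigma\in\operatorname{Hom}(H,K)$ and $\tau\in\operatorname{Hom}(K,H)$ such that $\sigma\tau$ and $\tau\sigma$ are normal, the only $k\in K$ with $\sigma\tau(k)=k$ is $k=1$ (equivalently, the only $h\in H$ with $\tau\sigma(h)=h$ is $h=1$). $H$ and $K$ are totally incompatible if for all $\sigma\in\operatorname{Hom}(H,K)$ and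 $\tau\in\operatorname{Hom}(K,H)$ such that $\sigma\tau$ and $\tau\sigma$ are normal, for every $k\in K$ there is a positive integer $n$ with $(\sigma\tau)^n(k)=1$ (equivalently, for every $h\in H$ there is a positive integer $n$ with $(\tau\sigma)^n(h)=1$). *)

(* Defs.v *)
From HB Require Import structures.
From mathcomp Require Import all_boot.
From mathcomp Require Import boolp classical_sets.

Set Implicit Arguments.
Unset Strict Implicit.
Unset Printing Implicit Defensive.

Local Open Scope classical_set_scope.
Local Open Scope group_scope.

Notation Hom := UMagmaMorphism.type (only parsing).

Section Groups.
Variable G : groupType.

Definition center : set G := [set z | forall g : G, commute z g].

Definition normal_subgroup (N : set G) : Prop :=
  [/\ N 1,
      forall x y, N x -> N y -> N (x * y),
      forall x, N x -> N x^-1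
    & forall x g, N x -> N (x ^ g)].

Definition min_normal : Prop :=
  forall F : set (set G), F `<=` normal_subgroup -> F !=set0 ->
  exists2 M, F M & forall N, F N -> N `<=` M -> N = M.

(* [x ^ g] is the conjugate [g^-1 * x * g]: [f] commutes with every inner
   automorphism. *)
Definition normal_endo (f : G -> G) : Prop :=
  forall g : G, {morph f : x / x ^ g}.

Definition Aut : set (G -> G) := [set f | monoid_morphism f /\ bijective f].

End Groups.

Arguments center G : clear implicits.
Arguments min_normal G : clear implicits.
Arguments Aut G : clear implicits.

Section Pairs.
Variables H K : groupType.

Definition incompatible : Prop :=
  forall (sigma : Hom H K) (tau : Hom K H),
    normal_endo (sigma \o tau) -> normal_endo (tau \o sigma) ->
  forall k : K, (sigma \o tau) k = k -> k = 1.

Definition totally_incompatible : Prop :=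
  forall (sigma : Hom H K) (tau : Hom K H),
    normal_endo (sigma \o tau) -> normal_endo (tau \o sigma) ->
  forall k : K, exists2 n : nat, (0 < n)%N & iter n (sigma \o tau) k = 1.

(* The matrix (alpha beta; gamma delta). *)
Record hommx := HomMx {
  mx_alpha : Hom H H;
  mx_beta  : Hom K H;
  mx_gamma : Hom H K;
  mx_delta : Hom K K
}.

(* For arbitrary entries this map need not be a morphism: that requires the
   images of alpha and beta to commute, and those of gamma and delta too. *)
Definition hommx_fun (M : hommx) (x : H * K) : H * K :=
  (mx_alpha M x.1 * mx_beta M x.2, mx_gamma M x.1 * mx_delta M x.2).

Definition calA : set hommx :=
  [set M | [/\ bijective (mx_alpha M), bijective (mx_delta M),
               range (mx_beta M) `<=` center H
             & range (mx_gamma M) `<=` center K]].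

End Pairs.

Arguments calA H K : clear implicits.

Lemma hom_ext (G H : groupType) (f g : Hom G H) : f =1 g -> f = g.
Proof.
case: f g => [f [[f1] [f2]]] [g [[g1] [g2]]] /= /funext fg.
by case: _ / fg in g1 g2 *; rewrite (Prop_irrelevance f1 g1) (Prop_irrelevance f2 g2).
Qed.

(* An endomorphism of [H * K] is identified with the only matrix representing
   it. *)
Lemma endo_hommx (H K : groupType) (f : H * K -> H * K) :
  monoid_morphism f -> exists! M : hommx H K, hommx_fun M = f.
Proof.
move=> [f1 fM].
have inlP : monoid_morphism (fun h : H => (h, 1 : K)).
  by split=> // x y; congr (_, _); rewrite mulg1.
have inrP : monoid_morphism (fun k : K => (1 : H, k)).
  by split=> // x y; congr (_, _); rewrite mulg1.
pose homof (A B : groupType) (u : A -> B) (uP : monoid_morphism u) : Hom A B :=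
  HB.pack u (isUMagmaMorphism.Build A B u uP).
pose F := homof _ _ f (f1, fM).
pose il := homof _ _ _ inlP; pose ir := homof _ _ _ inrP.
pose M := @HomMx H K (fst \o (F \o il)) (fst \o (F \o ir))
            (snd \o (F \o il)) (snd \o (F \o ir)).
have ME : hommx_fun M = f.
  apply: funext => -[h k]; rewrite /hommx_fun /=.
  have -> : (h, k) = (h, 1 : K) * (1 : H, k) by congr (_, _); rewrite ?mulg1 ?mul1g.
  by rewrite fM; case: (f (h, 1)) (f (1, k)) => [? ?] [? ?].
exists M; split=> // N; rewrite -ME => /funeqP E.
have E1 h : hommx_fun M (h, 1) = hommx_fun N (h, 1) by rewrite E.
have E2 k : hommx_fun M (1, k) = hommx_fun N (1, k) by rewrite E.
case: M N E1 E2 {ME E} => [a b c d] [a' b' c' d'].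
rewrite /hommx_fun /= => E1 E2; congr HomMx; apply: hom_ext => x.
- by have [] := E1 x; rewrite !gmulf1 !mulg1.
- by have [] := E2 x; rewrite !gmulf1 !mul1g.
- by have [] := E1 x; rewrite !gmulf1 !mulg1.
- by have [] := E2 x; rewrite !gmulf1 !mul1g.
Qed.

(* Main.v *)
Require Import Defs.
From HB Require Import structures.
From mathcomp Require Import all_boot.
From mathcomp Require Import boolp classical_sets.
Local Open Scope classical_set_scope.

(** Write an automorphism and its inverse as matrices (alpha beta; gamma delta)
    and (alpha' beta'; gamma' delta').  The diagonal entries of their product
    read gamma' beta + delta' delta = 1 on K and beta' gamma + alpha' alpha = 1
    on H.  Two endomorphisms with f + g = 1 have commuting images, hence are
    normal; so incompatibility applies to f = gamma' beta, and as the kernel of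
    g consists of the fixed points of f, g = delta' delta is injective.  It is
    surjective because an injective normal endomorphism of a group with the
    minimal condition is, or, if f is pointwise nilpotent, by summing the
    geometric series of f.  Conversely, inverting a matrix of [calA] amounts to
    inverting 1 - gamma alpha^-1 beta delta^-1, to which the same argument
    applies. *)

Set Implicit Arguments.
Unset Strict Implicit.
Unset Printing Implicit Defensive.
Local Open Scope group_scope.

Lemma inj_surj_bijective (A B : Type) (f : A -> B) :
  injective f -> (forall y, exists x, f x = y) -> bijective f.
Proof.
by move=> f_inj /choice[g fK]; exists g => // x; apply: f_inj; rewrite fK.
Qed.

Lemma hom_morphism (G G' : groupType) (f : Hom G G') : monoid_morphism f.
Proof. by split; [apply: gmulf1 | apply: gmulfM]. Qed.

Lemma can_morphism (G G' : groupType) (f : G -> G') (g : G' -> G) :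
  monoid_morphism f -> cancel f g -> cancel g f -> monoid_morphism g.
Proof.
move=> [f1 fM] fK gK; split; first by rewrite -f1 fK.
by move=> x y; apply: (can_inj fK); rewrite fM !gK.
Qed.

Lemma range_centerP (G G' : groupType) (f : G -> G') :
  range f `<=` center G' -> forall x y, commute (f x) y.
Proof. by move=> fZ x; apply: (fZ (f x)); exists x. Qed.

Definition mkHom (G G' : groupType) (f : G -> G') (fP : monoid_morphism f) :
  Hom G G' := HB.pack f (isUMagmaMorphism.Build G G' f fP).

Section OneGroup.
Variable G : groupType.
Implicit Types f g u : Hom G G.

Lemma range_normal u : normal_endo u -> normal_subgroup (range u).
Proof.
move=> uJ; split.
- by exists 1; rewrite ?gmulf1.
- by move=> _ _ [x _ <-] [y _ <-]; exists (x * y); rewrite ?gmulfM.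
- by move=> _ [x _ <-]; exists x^-1; rewrite ?gmulfV.
- by move=> _ z [x _ <-]; exists (x ^ z); rewrite ?uJ.
Qed.

(** Among the images of all injective normal endomorphisms take a minimal one, [range u]. Then
    [u \o g] has the same image, and injectivity cancels [u]. *)
Lemma min_normal_surj g : min_normal G -> normal_endo g -> injective g ->
  forall y, exists x, g x = y.
Proof.
move=> Gmin gJ g_inj.
have [||_ [u [uJ u_inj] <-] umin] :=
    Gmin [set range u | u in [set u : Hom G G | normal_endo u /\ injective u]].
- by move=> _ [u [uJ _] <-]; apply: range_normal.
- by exists (range g); exists g.
have ugE : range (u \o g) = range u.
  apply: umin; last by move=> _ [x _ <-]; exists (g x).
  exists (u \o g) => //; split; last exact: inj_comp.
  by move=> z x; rewrite /= gJ uJ.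
move=> y; have [x _ /u_inj <-] : range (u \o g) (u y) by rewrite ugE; exists y.
by exists x.
Qed.

Section Complement.
Variables f g : Hom G G.
Hypothesis fgE : forall x, f x * g x = x.

(** Expand [y * x] both as [f y * f x * g y * g x] and as [f y * g y * f x * g x], then cancel the
    outer factors. *)
Lemma compl_comm x y : commute (f x) (g y).
Proof.
have := fgE (y * x).
rewrite !gmulfM -[in RHS](fgE x) -[in RHS](fgE y) !mulgA => /mulIg.
by rewrite -!mulgA => /mulgI.
Qed.

Lemma compl_sym x : g x * f x = x.
Proof. by rewrite -compl_comm fgE. Qed.

(** Conjugation by [z = f z * g z] acts on the image of [f] as conjugation by [f z], since [g z]
    centralizes that image. *)
Lemma compl_normal : normal_endo f.
Proof.
move=> z x; rewrite -[in RHS](fgE z) conjgM gmulfJ.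
apply/esym/conjg_fixP/commgP; rewrite -gmulfJ; exact: compl_comm.
Qed.

(** The preimage of [y] is the finite geometric product [f^(n-1) y * ... * f y * y]. *)
Lemma compl_iter_surj n y : iter n f y = 1 -> exists x, g x = y.
Proof.
elim: n y => [|n IHn] y; first by move=> /= ->; exists 1; rewrite gmulf1.
by rewrite iterSr => /IHn[x gx]; exists (x * y); rewrite gmulfM gx fgE.
Qed.

End Complement.

Lemma compl_bijective f g : (forall x, f x * g x = x) ->
    (forall x, f x = x -> x = 1) ->
    min_normal G \/ (forall x, exists n, iter n f x = 1) ->
  bijective g.
Proof.
move=> fgE f_fix Gfin.
have g_inj : injective g.
  by apply: gmulf_inj => x gx; apply: f_fix; rewrite -[RHS]fgE gx mulg1.
apply: inj_surj_bijective => //; case: Gfin => [Gmin | f_nil] y.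
  by apply: min_normal_surj => //; apply: compl_normal (compl_sym fgE).
by have [n] := f_nil y; apply: compl_iter_surj.
Qed.

Lemma central_normal f : range f `<=` center G -> normal_endo f.
Proof.
move=> fZ z x; have fxJ y : f x ^ y = f x.
  exact/conjg_fixP/commgP/range_centerP.
by rewrite gmulfJ !fxJ.
Qed.

Lemma central_compl f : range f `<=` center G ->
  exists g, forall x, f x * g x = x.
Proof.
move=> fZ; have gP : monoid_morphism (fun x => (f x)^-1 * x).
  split=> [|x y]; first by rewrite gmulf1 invg1 mul1g.
  have fVC z t : commute (f z)^-1 t.
    exact/commute_sym/commuteV/commute_sym/range_centerP.
  by rewrite gmulfM invgM !mulgA; congr (_ * _); rewrite -mulgA (fVC y).
by exists (mkHom gP) => x /=; rewrite mulVKg.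
Qed.

End OneGroup.

Definition hypC (H K : groupType) :=
  (incompatible H K /\ min_normal H /\ min_normal K)
    \/ totally_incompatible H K.

(** Both notions test only endomorphisms of the second group. A fixed point [x] of [s \o t] yields
    the fixed point [t x] of [t \o s]; for nilpotency the transfer costs one more iteration. *)
Lemma hypC_sym (H K : groupType) : hypC H K -> hypC K H.
Proof.
case=> [[HKi [Hmin Kmin]] | HKt]; [left; split=> // | right] => s t stN tsN x.
  move=> /= stx; have tx : t x = 1 by apply: (HKi t s) => //=; rewrite stx.
  by rewrite -stx tx gmulf1.
have [n _ tsn_eq] := HKt t s tsN stN (t x); exists n.+1 => //.
have {}tsn m y : t (iter m (s \o t) y) = iter m (t \o s) (t y).
  by elim: m => //= m ->.
by rewrite /= tsn tsn_eq gmulf1.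
Qed.

Lemma hypC_compl_bijective (H K : groupType) (s : Hom H K) (t : Hom K H)
    (g : Hom K K) : hypC H K ->
    normal_endo (s \o t) -> normal_endo (t \o s) ->
  (forall k, s (t k) * g k = k) -> bijective g.
Proof.
move=> hHK stN tsN stgE; apply: (compl_bijective (f := s \o t)) => //.
  case: hHK => [[HKi _] | HKt]; first exact: HKi.
  (* A fixed point equals all its iterates, one of which is 1. *)
  move=> k stk; have [n _ <-] := HKt s t stN tsN k.
  by elim: n => //= n <-.
case: hHK => [[_ [_ Kmin]] | HKt]; first by left.
by right=> k; have [n _ stn] := HKt s t stN tsN k; exists n.
Qed.

(* [b], [c], [d] are the last three entries of a matrix, and [b'], [c'], [d']
   those of its inverse. *)
Lemma corner_bijective (H K : groupType) (b b' : Hom K H) (c c' : Hom H K)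
    (d d' : Hom K K) : hypC H K ->
    (forall k, c' (b k) * d' (d k) = k) -> (forall k, c (b' k) * d (d' k) = k) ->
    normal_endo (b \o c') -> normal_endo (b' \o c) ->
  bijective d.
Proof.
move=> hHK E' E bcN bcN'.
have bij1 : bijective (d' \o d).
  apply: (@hypC_compl_bijective _ _ c' b) => //.
  exact: (compl_normal (f := c' \o b) (g := d' \o d)).
have [h _ hK] : bijective (d \o d').
  apply: (@hypC_compl_bijective _ _ c b') => //.
  exact: (compl_normal (f := c \o b') (g := d \o d')).
apply: inj_surj_bijective; first exact: inj_compr (bij_inj bij1).
by move=> y; exists (d' (h y)); apply: hK.
Qed.

Section TwoGroups.
Variables H K : groupType.
Implicit Types M N : hommx H K.

Lemma hommx_can_diag M N : cancel (hommx_fun M) (hommx_fun N) ->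
  (forall h, mx_alpha N (mx_alpha M h) * mx_beta N (mx_gamma M h) = h) /\
  (forall k, mx_gamma N (mx_beta M k) * mx_delta N (mx_delta M k) = k).
Proof.
move=> MK; split=> [h | k].
  by have [] := MK (h, 1); rewrite /= !gmulf1 !mulg1.
by have [] := MK (1, k); rewrite /= !gmulf1 !mul1g.
Qed.

(** The elements [(1, k)] and [(h, 1)] commute, hence so do their images. *)
Lemma hommx_comm M : monoid_morphism (hommx_fun M) -> forall h k,
  commute (mx_alpha M h) (mx_beta M k) /\ commute (mx_gamma M h) (mx_delta M k).
Proof.
move=> [_ fM] h k.
have := fM (1, k) (h, 1); rewrite /hommx_fun /=.
by rewrite !(gmulf1, mul1g, mulg1) => -[].
Qed.

Lemma Aut_calA M : hypC H K -> Aut (H * K)%type (hommx_fun M) -> calA H K M.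
Proof.
move=> hHK [fP [f' fK f'K]].
have [N [NE _]] := endo_hommx (can_morphism fP fK f'K).
rewrite -NE in fK f'K.
have [EH EK] := hommx_can_diag fK; have [EH' EK'] := hommx_can_diag f'K.
have {}EH := compl_sym (f := mx_alpha N \o mx_alpha M) (g := mx_beta N \o mx_gamma M) EH.
have {}EH' := compl_sym (f := mx_alpha M \o mx_alpha N) (g := mx_beta M \o mx_gamma N) EH'.
have NH := compl_normal (f := mx_beta N \o mx_gamma M) (g := mx_alpha N \o mx_alpha M) EH.
have NH' := compl_normal (f := mx_beta M \o mx_gamma N) (g := mx_alpha M \o mx_alpha N) EH'.
have NK := compl_normal (f := mx_gamma N \o mx_beta M) (g := mx_delta N \o mx_delta M) EK.
have NK' := compl_normal (f := mx_gamma M \o mx_beta N) (g := mx_delta M \o mx_delta N) EK'.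
have d_bij := corner_bijective hHK EK EK' NH' NH.
have a_bij := corner_bijective (hypC_sym hHK) EH EH' NK' NK.
(* The image of beta commutes with that of alpha, which is now all of [H]; similarly for gamma and
   delta. *)
split=> //.
  case: a_bij => a' _ aK _ [k _ <-] h; rewrite -(aK h).
  by apply: commute_sym; case: (hommx_comm fP (a' h) k).
case: d_bij => d' _ dK _ [h _ <-] k; rewrite -(dK k).
by case: (hommx_comm fP h (d' k)).
Qed.

Lemma calA_Aut M : hypC H K -> calA H K M -> Aut (H * K)%type (hommx_fun M).
Proof.
case: M => a b c d hHK [/= [a' aK a'K] [d' dK d'K] bZ cZ].
have bC := range_centerP bZ; have cC := range_centerP cZ.
pose ai : Hom H H := mkHom (can_morphism (hom_morphism a) aK a'K).
pose di : Hom K K := mkHom (can_morphism (hom_morphism d) dK d'K).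
pose s : Hom H K := c \o ai; pose t : Hom K H := b \o di.
have stZ : range (s \o t) `<=` center K by move=> _ [k _ <-]; apply: cC.
have tsZ : range (t \o s) `<=` center H by move=> _ [h _ <-]; apply: bC.
(* Here [g] is [1 - s \o t], so [g \o d] is the Schur complement of [a] in the matrix. *)
have [g gE] := central_compl (f := s \o t) stZ.
have [g' gK g'K] : bijective g.
  by apply: (hypC_compl_bijective hHK (s := s) (t := t)) => //;
    exact: (central_normal (f := _ \o _)).
have fM : monoid_morphism (hommx_fun (HomMx a b c d)).
  split; first by rewrite /hommx_fun /= !gmulf1 !mulg1.
  move=> [h k] [h' k']; rewrite /hommx_fun /= !gmulfM; congr (_, _).
    by rewrite -!mulgA; congr (_ * _); rewrite !mulgA bC.
  by rewrite -!mulgA; congr (_ * _); rewrite !mulgA cC.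
split=> //; apply: inj_surj_bijective.
  apply: (@gmulf_inj _ _ (mkHom fM)) => -[h k] /= [E1 E2].
  (* Eliminating [h] from the kernel equations shows that [s \o t] fixes [d k], so [g (d k) = 1]. *)
  have hE : h = (ai (b k))^-1.
    by rewrite -gmulfV -(mulg1_eq E1) invgK /= aK.
  have dkE : s (b k) = d k by rewrite -(mulg1_eq E2) hE gmulfV invgK.
  have dk : d k = 1.
    apply: (can_inj gK); rewrite gmulf1; apply: (mulgI (d k)).
    by rewrite mulg1 -[RHS]gE /= dK -dkE.
  have {}dk : k = 1 by rewrite -[k]dK dk -[RHS]dK gmulf1.
  by rewrite hE dk !gmulf1 invg1.
(* Block elimination: with [k1 = d k], the second coordinate becomes [s h0 * g k1 = k0]. *)
move=> [h0 k0]; pose k1 := g' ((s h0)^-1 * k0).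
exists (ai (h0 * (b (di k1))^-1), di k1); congr (_, _) => /=.
  by rewrite a'K mulgVK.
have k1E : s (t k1) * ((s h0)^-1 * k0) = k1 by rewrite -[RHS]gE g'K.
rewrite d'K -[X in _ * X = _]k1E -[c _]/(s (h0 * (t k1)^-1)).
by rewrite gmulfM gmulfV mulgA mulgVK mulVKg.
Qed.

End TwoGroups.

Theorem theoremC (H K : groupType) :
  (incompatible H K /\ min_normal H /\ min_normal K)
    \/ totally_incompatible H K ->
  Aut (H * K)%type = [set hommx_fun M | M in calA H K].
Proof.
move=> hHK; apply/seteqP; split=> [f fA | _ [M MA <-]]; last exact: calA_Aut.
have [M [ME _]] := endo_hommx fA.1.
by exists M => //; apply: Aut_calA; rewrite ?ME.
Qed.
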